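(* Let $b\ge 1$ and $n\ge 3$ with $n\ne 6$, and let $D(T_6 \circledcirc T_n^{(b)})$ be the distance matrix of the graph $T_6 \circledcirc T_n^{(b)}$. Then $$\det D(T_6 \circledcirc T_n^{(b)}) = (-1)^{nb+1}\, 2^{(n-3)b+4}\,(n-6)^b.$$
   Context: For $n\ge 3$, $T_n$ is the complete tripartite graph $K_{1,1,n-2}$, i.e. $n-2$ triangles sharing a common base edge; the two vertices in the parts of size $1$ are its base vertices (endpoints of the common base), the remaining $n-2$ are non-base vertices. For $n\ne 6$ and $b\ge1$, $T_6\circledcirc T_n^{(b)}$ is the graph obtained from one copy of $T_6$ and $b$ copies of $T_n$ by choosing one non-base vertex in each copy and identifying all chosen vertices to a single (central cut) vertex; its blocks are exactly one $T_6$ and $b$ copies of $T_n$. The distance matrix has entries the graph distances. *)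

(* Defs.v *)
From mathcomp Require Import all_boot all_order all_algebra.

Set Implicit Arguments.
Unset Strict Implicit.
Unset Printing Implicit Defensive.

Import GRing.Theory.

Definition walk_of_length (T : finType) (e : rel T) (k : nat) (x y : T) : bool :=
  [exists p : k.-tuple T, path e x p && (last x p == y)].

(* Shortest paths have length < #|T|, so searching the lengths 0, ..., #|T| - 1
   is enough; vertices in different components get the junk value #|T|. *)
Definition graph_dist (T : finType) (e : rel T) (x y : T) : nat :=
  find (fun k => walk_of_length e k x y) (iota 0 #|T|).

Definition dist_mx (T : finType) (e : rel T) : 'M[int]_#|T| :=
  \matrix_(i, j) Posz (graph_dist e (enum_val i) (enum_val j)).

(* T_n = K_{1,1,n-2} on 'I_n: the parts are {0}, {1} and {2, ..., n-1}. *)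
Definition T_part (n : nat) (x : 'I_n) : nat := minn x 2.

Definition T_adj (n : nat) : rel 'I_n := fun x y => T_part x != T_part y.

Definition T_base (n : nat) (x : 'I_n) : bool := T_part x < 2.

(* Identification, in the disjoint union of the graphs (V i, e i), of all the
   vertices c i to a single vertex, represented by None.  The map glue sends a
   vertex of V i to its class, and the edges are the images of the edges of
   the e i. *)
Section Coalescence.
Variables (I : finType) (V : I -> finType).
Variables (e : forall i, rel (V i)) (c : forall i, V i).

Definition coalescence : finType := option {i : I & {x : V i | x != c i}}.

Definition glue (i : I) (x : V i) : coalescence :=
  omap (Tagged (fun i => {x : V i | x != c i})) (insub x).

Definition coalescence_adj : rel coalescence := fun u v =>
  [exists i : I, exists x : V i, exists y : V i,
     [&& e x y, glue x == u & glue y == v]].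

End Coalescence.

Arguments coalescence {I V} c.
Arguments coalescence_adj {I V} e c u v.

(* The blocks are indexed by option 'I_b: None is the copy of T_6, and the
   Some j are the b copies of T_n. *)
Definition block_order (b n : nat) (i : option 'I_b) : nat :=
  if i is Some _ then n else 6.

Definition T6_coal_adj (b n : nat)
    (c : forall i : option 'I_b, 'I_(block_order n i)) : rel (coalescence c) :=
  coalescence_adj (fun i => @T_adj (block_order n i)) c.

Arguments T6_coal_adj {b n} c u v.

(* Main.v *)
Require Import Defs.
From mathcomp Require Import all_boot all_order all_algebra.
From mathcomp Require Import fingroup perm zify ring.

Set Implicit Arguments.
Unset Strict Implicit.
Unset Printing Implicit Defensive.

Import GRing.Theory.

(** Distances add up along a coalescence: every vertex [u] has a nearest
vertex [coal_proj i u] in each block [i] (itself if it lies there, the central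
vertex otherwise), and the distance of [u] and [v] is the sum over the blocks
of the distances of their projections ([coalescence_is_dist]).  So a second
difference of the distance function, taken along two edges lying in different
blocks, vanishes.

Take in every copy of [T_m] the spanning tree in which the two base vertices
hang from the central vertex and the other vertices hang from the base vertex
[0], and replace each non-central row and column by its difference with the
row or column of its parent.  This unimodular congruence turns the distance
matrix into
[[
   0    1^t
   1  -(2 I + A)
]]
where [A] is the adjacency matrix of a disjoint union of stars, one per block:
its hub is the base vertex [1], its leaves are the [m - 2] other non-central
vertices ([tree_diff_dist]).  (For a tree the same differences give [A = 0],
which is the argument behind the Graham--Pollak formula.)

A star is diagonalised by subtracting its leaves from twice its hub; after
that the only off-diagonal entries left are in the central row and column.  The
resulting [arrow_mx] has [-2] on the diagonal at the leaves, [2 (m - 6)] at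
the hub of a block [T_m], and border entries [1] at the leaves and [4 - m] at
the hubs.  The order 6 is exactly the one at which the diagonal entry of the hub
vanishes: the hub of [T_6] meets only the central vertex, with entry [-2], so
swapping these two columns makes the matrix triangular.  Its determinant is
then read off the diagonal ([det_arrow_mx]), and dividing by the square
[4 ^ (number of blocks)] of the determinant of the second congruence gives the
result ([det_T_dist]). *)

(** * Recognising the graph distance *)

(** This packages what has to be checked to identify the distance of a
connected graph with a given function: it grows by at most one along an edge,
and from [y] one can always step back to a neighbour closer to [x].  These
properties pass from the blocks to a coalescence. *)
Definition is_dist (T : finType) (e : rel T) (d : T -> T -> nat) : Prop :=
  [/\ forall x, d x x = 0,
      forall x y z, e y z -> d x z <= (d x y).+1
    & forall x y, x != y -> exists2 z, e z y & d x y = (d x z).+1].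

Lemma walk_of_lengthP (T : finType) (e : rel T) k x y :
  reflect (exists p, [/\ path e x p, last x p = y & size p = k])
    (walk_of_length e k x y).
Proof.
apply: (iffP existsP) => [[p /andP[xp /eqP lp]]|[p [xp lp sp]]].
  by exists p; rewrite size_tuple.
by have /eqP sp' := sp; exists (Tuple sp'); rewrite /= xp lp eqxx.
Qed.

(** Growth by at most one per edge bounds the length of a walk from below; iterating
the step back produces a walk of length [d x y].  The search in [graph_dist]
reaches this length because a walk shortens to a duplicate-free path, which has
fewer than [#|T|] edges. *)
Lemma graph_distE (T : finType) (e : rel T) d :
  is_dist e d -> graph_dist e =2 d.
Proof.
move=> [dxx lip desc] x y.
have d_le p : path e x p -> d x (last x p) <= size p.
  elim/last_ind: p => [|p z IH] /=; first by rewrite dxx.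
  rewrite rcons_path last_rcons size_rcons => /andP[/IH le_p /lip le_d].
  exact: leq_trans (le_d x) _.
have walk k z : d x z = k -> walk_of_length e k x z.
  elim: k z => [|k IH] z dz.
    case: (eqVneq x z) => [<-|/desc[w _]]; last by rewrite dz.
    by apply/walk_of_lengthP; exists [::].
  have [xz|/desc[w ewz dw]] := eqVneq x z; first by rewrite -xz dxx in dz.
  have /IH/walk_of_lengthP[p [xp lp sp]] : d x w = k by rewrite dw in dz; case: dz.
  by apply/walk_of_lengthP; exists (rcons p z);
    rewrite rcons_path xp lp ewz last_rcons size_rcons sp.
have d_lt : d x y < #|T|.
  have /walk_of_lengthP[p [xp <- _]] := walk _ _ (erefl (d x y)).
  case: (shortenP xp) => q xq uq _.
  apply: leq_ltn_trans (d_le q xq) _; rewrite (cardE T).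
  by apply: (uniq_leq_size uq) => z; rewrite mem_enum.
rewrite /graph_dist; set a := fun k => _.
have ha : has a (iota 0 #|T|).
  by apply/hasP; exists (d x y); [rewrite mem_iota | exact: walk].
apply/eqP; rewrite eqn_leq; apply/andP; split.
  rewrite leqNgt; apply/negP => /(before_find 0).
  by rewrite nth_iota // add0n /a walk.
have := nth_find 0 ha; rewrite nth_iota ?add0n; last by rewrite has_find size_iota in ha.
by move=> /walk_of_lengthP[p [xp lp <-]]; rewrite -lp d_le.
Qed.

(** * Coalescences *)

Section CoalescenceTheory.
Variables (I : finType) (V : I -> finType) (c : forall i, V i).
Local Notation T := (coalescence c).

(** The gate of [u] in block [i]: the retraction of the coalescence onto its
block [i] that collapses all other blocks to the central vertex. *)
Definition coal_proj (i : I) (u : T) : V i :=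
  if u is Some w then untag (c i) (fun x : {x : V i | x != c i} => val x) w else c i.

Lemma glue_center i : glue c (c i) = None.
Proof. by rewrite /glue insubF ?eqxx. Qed.

Lemma glue_Some i (x : {x : V i | x != c i}) : glue c (val x) = Some (Tagged _ x).
Proof. by rewrite /glue valK. Qed.

Lemma coal_proj_glue i (x : V i) : coal_proj i (glue c x) = x.
Proof.
rewrite /glue; case: insubP => [w _ wx|] /=; first by rewrite untagE.
by rewrite negbK => /eqP.
Qed.

Lemma coal_proj_glueN i j (x : V i) : i != j -> coal_proj j (glue c x) = c j.
Proof. by rewrite /glue; case: insubP => [w _ _|] //= ij; rewrite untag_dflt. Qed.

(** Case analysis presenting a non-central vertex as [glue c x], so that no
dependent pair has to be handled afterwards. *)
Variant coal_spec : T -> Type :=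
  | CoalCenter : coal_spec None
  | CoalGlue i x of x != c i : coal_spec (glue c x).

Lemma coalP u : coal_spec u.
Proof.
case: u => [[i [x xc]]|]; last exact: CoalCenter.
have -> : Some (Tagged _ (exist _ x xc)) = glue c x :> T by rewrite -glue_Some.
exact: CoalGlue.
Qed.

(** The block [i] is the one in which the last edge of a geodesic from [u] to
[v] lies.  If [v] is central, any block where [u] projects off the centre
will do; otherwise it is the block of [v]. *)
Lemma glue_proj_neq (u v : T) : u != v ->
  exists2 i, coal_proj i u != coal_proj i v & glue c (coal_proj i v) = v.
Proof.
case: (coalP v) => [|i y yc].
  case: (coalP u) => [/eqP//|i x xc _].
  by exists i; rewrite /= ?coal_proj_glue ?glue_center.
have [uy|] := eqVneq (coal_proj i u) y; last first.
  by exists i; rewrite coal_proj_glue.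
case: (coalP u) uy => [/= cy|j x xc].
  by rewrite cy eqxx in yc.
have [ij|ji] := eqVneq i j; last first.
  by rewrite coal_proj_glueN 1?eq_sym // => cy; rewrite cy eqxx in yc.
by case: _ / ij in x xc *; rewrite coal_proj_glue => ->; rewrite eqxx.
Qed.

Variables (e : forall i, rel (V i)) (d : forall i, V i -> V i -> nat).

Definition coal_dist (u v : T) : nat :=
  \sum_i d (coal_proj i u) (coal_proj i v).

(** An edge changes the projection to a single block, along an edge of that block,
and leaves all other projections unchanged; so the properties in
[is_dist] pass from the blocks to the sum. *)
Lemma coalescence_is_dist : (forall i, is_dist (@e i) (@d i)) ->
  is_dist (coalescence_adj (fun i => @e i) c) coal_dist.
Proof.
move=> dP.
have sumE u i (x : V i) : coal_dist u (glue c x) =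
    d (coal_proj i u) x + \sum_(j | j != i) d (coal_proj j u) (c j).
  rewrite /coal_dist (bigD1 i) //= coal_proj_glue; congr (_ + _).
  by apply: eq_bigr => j ji; rewrite coal_proj_glueN // eq_sym.
split=> [u|u v w|u v].
- by apply: big1 => i _; case: (dP i) => ->.
- move=> /existsP[i /existsP[x /existsP[y /and3P[exy /eqP<- /eqP<-]]]].
  rewrite !sumE -addSn leq_add2r.
  by case: (dP i) => _ lip _; apply: lip.
- move=> /glue_proj_neq[i uv vE]; case: (dP i) => _ _ /(_ _ _ uv)[z ez dz].
  exists (glue c z).
    by apply/existsP; exists i; apply/existsP; exists z; apply/existsP;
      exists (coal_proj i v); rewrite ez vE !eqxx.
  by rewrite -[in LHS]vE !sumE dz.
Qed.

Lemma big_coalescence (R : Type) (idx : R) (op : Monoid.com_law idx) (F : T -> R) :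
  \big[op/idx]_u F u =
    op (F None) (\big[op/idx]_i \big[op/idx]_(x : V i | x != c i) F (glue c x)).
Proof.
rewrite (bigD1 None) //=; congr (op _ _).
rewrite (reindex_omap Some id) => [|[]//].
rewrite (eq_bigl xpredT); last by move=> w; rewrite eqxx.
under [RHS]eq_bigr => i _ do rewrite (big_sub (fun x : V i => x != c i)) /=.
rewrite sig_big_dep /=; apply: eq_bigr => -[i x] _ /=.
by rewrite (glue_Some x).
Qed.

End CoalescenceTheory.

Arguments coal_proj {I V} c i u.

(** All functions below on a coalescence are built with [coal_fun], so that
[coal_fun_glue] computes them on the presentation given by [coalP]. *)

Section CoalescenceFun.
Variables (I : finType) (V : I -> finType) (c : forall i, V i).
Variables (R : Type) (r0 : R) (g : forall i, V i -> R).

Definition coal_fun (u : coalescence c) : R :=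
  if u is Some w then g (val (tagged w)) else r0.

Lemma coal_fun_glue i (x : V i) : x != c i -> coal_fun (glue c x) = g x.
Proof. by move=> xc; rewrite -[x]/(val (Sub x xc : {x | x != c i})) glue_Some. Qed.

End CoalescenceFun.

Section GlueEq.
Variables (I : finType) (V : I -> finType) (c : forall i, V i).

Lemma glue_inj i : injective (@glue I V c i).
Proof. by move=> x y xy; rewrite -(coal_proj_glue c x) xy coal_proj_glue. Qed.

Lemma glue_eqNone i (x : V i) : (glue c x == None) = (x == c i).
Proof. by rewrite -(glue_center c i) (inj_eq (@glue_inj i)). Qed.

Lemma glue_neq i j (x : V i) (y : V j) : i != j -> x != c i -> (glue c x == glue c y) = false.
Proof.
move=> ij xc; apply/eqP => /(congr1 (coal_proj c i)).
by rewrite coal_proj_glue coal_proj_glueN 1?eq_sym // => /eqP; rewrite (negPf xc).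
Qed.

End GlueEq.

(** * The distance in a complete tripartite graph *)

Definition T_dist (n : nat) (x y : 'I_n) : nat :=
  if x == y then 0 else (T_part x == T_part y).+1.

Lemma T_is_dist n : 2 < n -> is_dist (@T_adj n) (@T_dist n).
Proof.
move=> n_gt2; split=> [x|x y z|x y xy].
- by rewrite /T_dist eqxx.
- rewrite /T_dist /T_adj; case: (eqVneq x y) => [->|_].
    by move=> /negPf->; case: ifP.
  by case: ifP => // _ _; case: (T_part x == T_part z).
- rewrite {1}/T_dist (negPf xy).
  have [xy2|] := eqVneq (T_part x) (T_part y); last by exists x => //; rewrite /T_dist eqxx.
  (* Two vertices in the same part are non-base vertices: the base vertex 0 is a
     common neighbour. *)
  have n_gt0 : 0 < n by apply: leq_trans n_gt2.
  have x_gt1 : 1 < x by move: xy xy2; rewrite -val_eqE /T_part /=; lia.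
  have y_gt1 : 1 < y by move: xy xy2; rewrite -val_eqE /T_part /=; lia.
  exists (Ordinal n_gt0).
    by rewrite /T_adj /T_part /= (minn_idPr y_gt1).
  rewrite /T_dist /T_part -!val_eqE /= (minn_idPr x_gt1).
  by case: (val x) x_gt1.
Qed.

(** * Determinants of matrices indexed by a finite type *)

Local Open Scope ring_scope.

Section FinMatrix.
Variables (R : comNzRingType) (T : finType).
Implicit Types A B : T -> T -> R.

Definition fmx A : 'M[R]_#|T| := \matrix_(i, j) A (enum_val i) (enum_val j).

Lemma sum_delta (f : T -> R) x : \sum_z f z * (z == x)%:R = f x.
Proof.
rewrite (bigD1 x) //= eqxx mulr1 big1 ?addr0 // => z /negPf->.
by rewrite mulr0.
Qed.

(** [L] is right multiplication by [B], seen as an operator on functions of the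
column index; the entries of [B^T *m A *m B] are then found by applying [L] to
each argument of [A], without expanding double sums. *)
Lemma det_congruence A B (L : (T -> R) -> T -> R) :
  (forall f y, \sum_z f z * B z y = L f y) ->
  \det (fmx (fun x y => L (fun z => L (A z) y) x)) = \det (fmx B) ^+ 2 * \det (fmx A).
Proof.
move=> BL; transitivity (\det ((fmx B)^T *m (fmx A *m fmx B))); last first.
  by rewrite !det_mulmx det_tr; ring.
congr (\det _); apply/matrixP=> i j.
rewrite !mxE -BL (reindex _ (onW_bij _ (enum_val_bij T))) /=.
apply: eq_bigr => k _.
rewrite !mxE -BL (reindex _ (onW_bij _ (enum_val_bij T))) /= mulrC; congr (_ * _).
by apply: eq_bigr => l _; rewrite !mxE.
Qed.

(** In the Leibniz expansion, a permutation [s] other than the identity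
contributes nothing: among the points that [s] moves take [i] with [r]
maximal; then [s i] is moved too, so [r] does not increase from [i] to [s i]
and the entry at [(i, s i)] is zero. *)
Lemma det_triangular A (r : T -> nat) :
  (forall x y, x != y -> A x y != 0 -> (r x < r y)%N) ->
  \det (fmx A) = \prod_x A x x.
Proof.
move=> Ar; rewrite /determinant (bigD1 (1 : 'S_#|T|)%g) //= odd_perm1 expr0 mul1r.
rewrite [X in _ + X]big1 ?addr0 => [|s s_neq1].
  by rewrite (reindex _ (onW_bij _ (enum_val_bij T))); apply: eq_bigr => i _; rewrite mxE perm1.
have /existsP[i0 si0] : [exists i, s i != i].
  rewrite -negb_forall; apply: contra s_neq1 => /forallP s1.
  by apply/eqP/permP => i; rewrite perm1; apply/eqP.
case: (@arg_maxnP _ i0 (fun i => s i != i) (fun i => r (enum_val i)) si0) => i si imax.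
have [Ai0|Ai] := eqVneq (A (enum_val i) (enum_val (s i))) 0.
  by rewrite (bigD1 i) //= mxE Ai0 mul0r mulr0.
have := Ar _ _ _ Ai; rewrite (inj_eq enum_val_inj) eq_sym => /(_ si).
rewrite ltnNge => /negP[]; apply: imax.
by rewrite (inj_eq perm_inj).
Qed.

Lemma det_swap_cols A (x y : T) : x != y ->
  \det (fmx (fun u v => A u (tperm x y v))) = - \det (fmx A).
Proof.
move=> xy.
have -> : fmx (fun u v => A u (tperm x y v)) = xcol (enum_rank x) (enum_rank y) (fmx A).
  apply/matrixP => i j; rewrite !mxE; congr (A _ _).
  by apply: enum_rank_inj; rewrite enum_valK (inj_tperm _ _ _ enum_rank_inj) enum_valK.
by rewrite xcolE det_mulmx det_perm odd_tperm (inj_eq enum_rank_inj) xy expr1 mulrN1.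
Qed.

End FinMatrix.

(** * The spanning-tree congruence *)

Section TCoalescence.
Variables (I : finType) (m : I -> nat) (c : forall i, 'I_(m i)).
Hypothesis c_nonbase : forall i, ~~ T_base (c i).
Local Notation T := (coalescence c).
Local Notation D := (fun u v : T => Posz (coal_dist (fun i => @T_dist (m i)) u v)).

Lemma center_gt1 i : (1 < c i)%N.
Proof. by have := c_nonbase i; rewrite /T_base /T_part; lia. Qed.

Lemma order_gt2 i : (2 < m i)%N.
Proof. exact: leq_ltn_trans (center_gt1 i) (ltn_ord (c i)). Qed.

(** [T_base (c i)] fails only if the block has a vertex with value at least 2,
so that both base vertices exist. *)
Definition base0 i : 'I_(m i) := Ordinal (ltn_trans (ltn0Sn 1) (order_gt2 i)).
Definition base1 i : 'I_(m i) := Ordinal (ltn_trans (ltnSn 1) (order_gt2 i)).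

Definition tree_parent i (x : 'I_(m i)) : 'I_(m i) :=
  if (x < 2)%N then c i else base0 i.

(** The entries of [-(2 I + A)] for the star with hub [1], on the values of the
vertices: a comparison in [nat] makes sense across blocks of different
types. *)
Definition star_entry (x y : nat) : int :=
  if x == y then -2 else - ((x == 1%N) != (y == 1%N))%:R.

(** The heart of the computation, a finite check: inside a block, the second
differences of the distance along the tree edges give the star. *)
Lemma T_dist_star i (x y : 'I_(m i)) : x != c i -> y != c i ->
  Posz (T_dist x y) - Posz (T_dist x (tree_parent y))
    - (Posz (T_dist (tree_parent x) y) - Posz (T_dist (tree_parent x) (tree_parent y)))
  = star_entry x y.
Proof.
rewrite /tree_parent /T_dist /T_part -!val_eqE /star_entry.
have := center_gt1 i; case: (ltnP x 2) => hx; case: (ltnP y 2) => hy /=;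
  repeat case: eqP => //=; lia.
Qed.

Lemma coal_dist_glue i (x y : 'I_(m i)) :
  coal_dist (fun i => @T_dist (m i)) (glue c x) (glue c y) = T_dist x y.
Proof.
rewrite /coal_dist (bigD1 i) //= !coal_proj_glue big1 ?addn0 // => j ji.
by rewrite !coal_proj_glueN 1?eq_sym // /T_dist eqxx.
Qed.

Lemma coal_dist_glueN i j (x : 'I_(m i)) (y : 'I_(m j)) : i != j ->
  coal_dist (fun i => @T_dist (m i)) (glue c x) (glue c y) =
    (T_dist x (c i) + T_dist (c j) y)%N.
Proof.
move=> ij; have ji : j != i by rewrite eq_sym.
rewrite /coal_dist (bigD1 i) //= (bigD1 j) //= addnA.
rewrite !coal_proj_glue !coal_proj_glueN // big1 ?addn0 // => k /andP[ki kj].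
by rewrite !coal_proj_glueN 1?eq_sym // /T_dist eqxx.
Qed.

Definition tree_diff (f : T -> int) : T -> int :=
  coal_fun (f None) (fun i (x : 'I_(m i)) => f (glue c x) - f (glue c (tree_parent x))).

Definition star_mx (u v : T) : int :=
  coal_fun (coal_fun 0 (fun _ _ => 1) v)
    (fun i (x : 'I_(m i)) => coal_fun 1 (fun j (y : 'I_(m j)) =>
       if i == j then star_entry x y else 0) v) u.

Lemma T_dist_tree_parent i (x : 'I_(m i)) : x != c i ->
  T_dist (c i) x = (T_dist (c i) (tree_parent x)).+1.
Proof.
have := center_gt1 i; rewrite /tree_parent /T_dist /T_part -!val_eqE.
by case: (ltnP x 2) => hx /=; repeat case: eqP => //=; lia.
Qed.

Lemma T_distC n (x y : 'I_n) : T_dist x y = T_dist y x.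
Proof. by rewrite /T_dist eq_sym [_ == T_part y]eq_sym. Qed.

(** For vertices in different blocks, the distance is a sum of a function of one
and a function of the other, which the differences cancel. *)
Lemma tree_diff_dist u v :
  tree_diff (fun z => tree_diff (D z) v) u = star_mx u v.
Proof.
rewrite /tree_diff /star_mx.
case: (coalP u) => [|i x xc]; case: (coalP v) => [|j y yc]; rewrite /= ?coal_fun_glue //.
- by rewrite /coal_dist big1 // => k _; rewrite /T_dist eqxx.
- by rewrite -(glue_center c j) !coal_dist_glue T_dist_tree_parent //; lia.
- by rewrite -(glue_center c i) !coal_dist_glue ![T_dist _ (c i)]T_distC T_dist_tree_parent //; lia.
- have [ij|ij] := eqVneq i j; last by rewrite !coal_dist_glueN //; lia.
  by case: _ / ij in y yc *; rewrite !coal_dist_glue T_dist_star.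
Qed.

Definition tree_mx (z u : T) : int :=
  coal_fun (z == None)%:R
    (fun i (x : 'I_(m i)) => (z == glue c x)%:R - (z == glue c (tree_parent x))%:R) u.

Lemma tree_mxE (f : T -> int) u : \sum_z f z * tree_mx z u = tree_diff f u.
Proof.
rewrite /tree_mx /tree_diff; case: (coalP u) => [|i x xc]; first exact: sum_delta.
under eq_bigr do rewrite coal_fun_glue // mulrBr.
by rewrite coal_fun_glue // sumrB !sum_delta.
Qed.

(** The matrix is unitriangular with respect to the depth [r] in the tree. *)
Lemma det_tree_mx : \det (fmx tree_mx) = 1.
Proof.
pose r : T -> nat := coal_fun 0%N (fun i (x : 'I_(m i)) => if (x < 2)%N then 1%N else 2%N).
have tpx i (x : 'I_(m i)) : x != c i -> (r (glue c (tree_parent x)) < r (glue c x))%N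
    /\ (glue c x == glue c (tree_parent x)) = false.
  move=> xc; rewrite (inj_eq (@glue_inj _ _ c i)) /tree_parent.
  have gt1 := center_gt1 i.
  case: (ltnP x 2) => x2 /=; first
   by rewrite glue_center {2}/r coal_fun_glue // x2 (negPf xc).
  rewrite /r !coal_fun_glue //; last by rewrite -val_eqE /=; lia.
  by rewrite [(x < 2)%N]ltnNge x2; split=> //; rewrite -val_eqE /=; lia.
rewrite (det_triangular (r := r)) => [|u v uv].
  apply: big1 => u _; rewrite /tree_mx; case: (coalP u) => [|i x xc] //=.
  by rewrite coal_fun_glue // eqxx (tpx _ _ xc).2 subr0.
rewrite /tree_mx; case: (coalP v) uv => [|i x xc] uv /=.
  by rewrite (negPf uv).
rewrite coal_fun_glue // (negPf uv) sub0r oppr_eq0.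
by case: (u =P glue c (tree_parent x)) => [-> _|//]; exact: (tpx _ _ xc).1.
Qed.

(** * The star congruence *)

(** Twice the column of each hub minus those of its leaves.  The coefficient 2
keeps the operation integral; it makes the determinant of the operation
[2 ^+ #|I|] instead of 1, which is cancelled at the end. *)
Definition star_diff (f : T -> int) : T -> int :=
  coal_fun (f None) (fun i (x : 'I_(m i)) =>
    if x == 1%N :> nat then
      f (glue c x) *+ 2 - \sum_(y : 'I_(m i) | (y != c i) && (y != 1%N :> nat)) f (glue c y)
    else f (glue c x)).

Definition star_diff_mx (z u : T) : int := star_diff (fun w => (z == w)%:R) u.

Lemma star_diff_mxE (f : T -> int) u : \sum_z f z * star_diff_mx z u = star_diff f u.
Proof.
rewrite /star_diff_mx /star_diff; case: (coalP u) => [|i x xc]; first exact: sum_delta.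
under eq_bigr do rewrite coal_fun_glue //.
rewrite coal_fun_glue //; case: eqP => _; last exact: sum_delta.
under eq_bigr do rewrite mulrBr mulrnAr mulr_sumr.
rewrite sumrB sumrMnl sum_delta exchange_big; congr (_ - _).
by apply: eq_bigr => y _; rewrite sum_delta.
Qed.

Lemma base1_neq_center i : base1 i != c i.
Proof. by have := center_gt1 i; rewrite -val_eqE /=; lia. Qed.

Lemma big_block (R : Type) (idx : R) (op : Monoid.com_law idx) i (F : 'I_(m i) -> R) :
  \big[op/idx]_(x | x != c i) F x =
    op (F (base1 i)) (\big[op/idx]_(x | (x != c i) && (x != 1%N :> nat)) F x).
Proof. by rewrite (bigD1 (base1 i)) ?base1_neq_center. Qed.

Lemma card_leaves i : #|[pred x : 'I_(m i) | (x != c i) && (x != 1%N :> nat)]| = (m i - 2)%N.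
Proof.
have := card_ord (m i); rewrite (cardD1 (c i)) (cardD1 (base1 i)) !inE base1_neq_center /=.
rewrite (@eq_card _ _ [pred x : 'I_(m i) | (x != c i) && (x != 1%N :> nat)]) => [mE|x].
  by rewrite -[X in (X - 2)%N]mE add1n add1n subn2.
by rewrite !inE andbT andbC -val_eqE.
Qed.

Lemma det_star_diff_mx : \det (fmx star_diff_mx) = 2 ^+ #|I|.
Proof.
pose r : T -> nat := coal_fun 0%N (fun i (x : 'I_(m i)) => (x == 1%N :> nat) : nat).
have leaf0 i u : (forall y : 'I_(m i), y != c i -> y != 1%N :> nat -> u != glue c y) ->
   \sum_(y : 'I_(m i) | (y != c i) && (y != 1%N :> nat)) (u == glue c y)%:R = 0 :> int.
  by move=> uy; apply: big1 => y /andP[yc y1]; rewrite (negPf (uy y yc y1)).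
rewrite (det_triangular (r := r)) => [|u v uv].
  rewrite big_coalescence {1}/star_diff_mx /star_diff /= mul1r.
  rewrite -prodr_const; apply: eq_bigr => i _.
  rewrite big_block big1 => [|x /andP[xc x1]].
    rewrite /= mulr1 /star_diff_mx /star_diff coal_fun_glue ?base1_neq_center //= eqxx.
    rewrite leaf0 ?subr0 // => y _ y1; rewrite (inj_eq (@glue_inj _ _ c i)).
    by rewrite -val_eqE eq_sym.
  by rewrite /star_diff_mx /star_diff coal_fun_glue // (negPf x1) eqxx.
rewrite /star_diff_mx /star_diff; case: (coalP v) uv => [|i x xc] uv /=.
  by rewrite (negPf uv).
rewrite coal_fun_glue // (negPf uv); case: (nat_of_ord x =P 1%N) => // x1.
rewrite mul0rn sub0r oppr_eq0 => S0.
(* A nonzero off-diagonal entry sits in a hub column, at one of its leaves. *)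
have [y /andP[yc y1] uy] : exists2 y : 'I_(m i), (y != c i) && (y != 1%N :> nat) & u = glue c y.
  case: (pickP (fun y : 'I_(m i) => [&& y != c i, y != 1%N :> nat & u == glue c y])) => [y|noy].
    by case/and3P=> yc y1 /eqP uy; exists y; rewrite ?yc.
  rewrite leaf0 ?eqxx // in S0 => y yc y1.
  by have := noy y; rewrite yc y1 /= => ->.
by rewrite uy /r !coal_fun_glue // x1 (negPf y1).
Qed.

(** [star_mx] after the column operations only, and [arrow_mx] after the row
operations too. *)
Definition star_col_mx (u v : T) : int :=
  coal_fun (coal_fun 0 (fun j (y : 'I_(m j)) => if y == 1%N :> nat then 4 - (m j)%:Z else 1) v)
    (fun i (x : 'I_(m i)) => coal_fun 1 (fun j (y : 'I_(m j)) =>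
       if i == j then
         if y == 1%N :> nat then if x == 1%N :> nat then (m i)%:Z - 6 else 0
         else star_entry x y
       else 0) v) u.

Definition arrow_mx (u v : T) : int :=
  coal_fun (coal_fun 0 (fun j (y : 'I_(m j)) => if y == 1%N :> nat then 4 - (m j)%:Z else 1) v)
    (fun i (x : 'I_(m i)) =>
       coal_fun (if x == 1%N :> nat then 4 - (m i)%:Z else 1) (fun j (y : 'I_(m j)) =>
       if (i == j) && (x == y :> nat) then
         if x == 1%N :> nat then ((m i)%:Z - 6) *+ 2 else -2
       else 0) v) u.

Lemma star_entryC x y : star_entry x y = star_entry y x.
Proof. by rewrite /star_entry eq_sym; case: eqP => // _; rewrite eq_sym. Qed.

Lemma sum_leaves_const i (k : int) :
  \sum_(y : 'I_(m i) | (y != c i) && (y != 1%N :> nat)) k = k * ((m i)%:Z - 2).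
Proof.
rewrite sumr_const card_leaves -[LHS]mulr_natr natz; congr (_ * _).
by have := order_gt2 i; lia.
Qed.

Lemma sum_leaves_star_entry i (x : 'I_(m i)) : x != c i ->
  \sum_(y : 'I_(m i) | (y != c i) && (y != 1%N :> nat)) star_entry x y =
    if x == 1%N :> nat then 2 - (m i)%:Z else - 2.
Proof.
move=> xc; case: eqP => [x1|/eqP x1].
  rewrite (eq_bigr (fun=> -1)) => [|y /andP[_ y1]].
    by rewrite sum_leaves_const mulN1r opprB.
  by rewrite /star_entry x1 eq_sym (negPf y1).
rewrite (bigD1 x) ?xc //= big1 => [|y /andP[/andP[_ y1]]].
  by rewrite addr0 /star_entry eqxx.
by rewrite -val_eqE /star_entry eq_sym /= (negPf x1) (negPf y1) => /negPf->.
Qed.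

(** The hub column becomes [2 (-2) + (m - 2) = m - 6] at the hub, [2 (-1) + 2 = 0]
at its leaves and [2 - (m - 2) = 4 - m] at the centre. *)
Lemma star_diff_cols u v : star_diff (star_mx u) v = star_col_mx u v.
Proof.
rewrite /star_diff /star_mx /star_col_mx.
case: (coalP v) => [|j y yc]; case: (coalP u) => [|i x xc]; rewrite /= ?coal_fun_glue //.
- case: eqP => // _; rewrite (eq_bigr (fun=> 1)) => [|z /andP[zc _]]; last by rewrite coal_fun_glue.
  by rewrite sum_leaves_const; lia.
- have [ij|ij] := eqVneq i j; last first.
    case: eqP => // _; rewrite big1 => [|z /andP[zc _]]; first by rewrite mul0rn subr0.
    by rewrite !coal_fun_glue // (negPf ij).
  case: _ / ij in y yc *.
  case: eqP => // y1; rewrite (eq_bigr (fun z : 'I_(m i) => star_entry x z)) => [|z /andP[zc _]].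
    rewrite sum_leaves_star_entry // y1 /star_entry.
    by case: eqP => //= _; lia.
  by rewrite !coal_fun_glue // eqxx.
Qed.

Lemma star_diff_rows u v : star_diff (fun z => star_col_mx z v) u = arrow_mx u v.
Proof.
rewrite /star_diff /star_col_mx /arrow_mx.
case: (coalP u) => [|i x xc]; case: (coalP v) => [|j y yc]; rewrite /= ?coal_fun_glue //.
- case: eqP => // _; rewrite (eq_bigr (fun=> 1)) => [|z /andP[zc _]]; last by rewrite coal_fun_glue.
  by rewrite sum_leaves_const; lia.
- have [ij|ij] := eqVneq i j; last first.
    case: eqP => // _; rewrite big1 => [|z /andP[zc _]]; first by rewrite mul0rn subr0.
    by rewrite !coal_fun_glue // (negPf ij).
  case: _ / ij in y yc *.
  case: (nat_of_ord y =P 1%N) => [y1|/eqP y1].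
    rewrite y1 big1 ?subr0 => [|z /andP[zc z1]]; last first.
      by rewrite !coal_fun_glue // eqxx y1 eqxx (negPf z1).
    by case: eqP => //.
  rewrite (eq_bigr (fun z : 'I_(m i) => star_entry y z)) => [|z /andP[zc _]]; last first.
    by rewrite !coal_fun_glue // eqxx (negPf y1) star_entryC.
  rewrite sum_leaves_star_entry // (negPf y1) /star_entry.
  case: (nat_of_ord x =P 1%N) => [->|/eqP x1] /=; last by rewrite (negPf y1).
  by rewrite eq_sym (negPf y1).
Qed.

Lemma eq_star_diff f g : f =1 g -> star_diff f =1 star_diff g.
Proof.
move=> fg u; rewrite /star_diff; case: (coalP u) => [|i x xc] /=; first exact: fg.
by rewrite !coal_fun_glue // fg; under eq_bigr do rewrite fg.
Qed.

(** * The determinant *)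

(** Row and column [h], the hub of the block of order 6, have their only
nonzero entry in the central column and row.  After the exchange of columns
[None] and [h], the centre comes first, [h] last, and all other vertices
are between them and pairwise unrelated.  The constant is
[- (-2) * (-2) * (-2) ^ 4]: the sign of the exchange, the two swapped entries,
and the four leaves of the special block. *)
Lemma det_arrow_mx i0 : m i0 = 6%N ->
  \det (fmx arrow_mx) = - 64 * \prod_(i | i != i0) (((m i)%:Z - 6) *+ 2 * (-2) ^+ (m i - 2)).
Proof.
move=> m6; pose h := glue c (base1 i0).
have hN : None != h by rewrite eq_sym glue_eqNone base1_neq_center.
have WNh : arrow_mx None h = -2.
  by rewrite /arrow_mx /h /= coal_fun_glue ?base1_neq_center //= m6.
have WhN : arrow_mx h None = -2.
  by rewrite /arrow_mx /h coal_fun_glue ?base1_neq_center //= m6.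
have -> : \det (fmx arrow_mx) = - \det (fmx (fun u v => arrow_mx u (tperm None h v))).
  by rewrite det_swap_cols // opprK.
pose r (u : T) := if u == None then 0%N else if u == h then 2%N else 1%N.
rewrite (det_triangular (r := r)) => [|u v uv].
  rewrite big_coalescence tpermL WNh (bigD1 i0) //=.
  have prod_block i k : (forall x : 'I_(m i), x != c i -> x != 1%N :> nat ->
       arrow_mx (glue c x) (tperm None h (glue c x)) = -2) ->
     arrow_mx (glue c (base1 i)) (tperm None h (glue c (base1 i))) = k ->
     \prod_(x : 'I_(m i) | x != c i) arrow_mx (glue c x) (tperm None h (glue c x)) =
      k * (-2) ^+ (m i - 2).
    move=> Wleaf Wk; rewrite big_block /= Wk; congr (_ * _).
    rewrite (eq_bigr (fun=> -2)) => [|x /andP[xc x1]]; last exact: Wleaf.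
    by rewrite prodr_const card_leaves.
  have Wleaf i (x : 'I_(m i)) : x != c i -> x != 1%N :> nat ->
       arrow_mx (glue c x) (tperm None h (glue c x)) = -2.
    move=> xc x1; rewrite tpermD.
    - by rewrite /arrow_mx !coal_fun_glue // !eqxx (negPf x1).
    - by rewrite eq_sym glue_eqNone.
    - apply/eqP => hx; have := x1.
      have [ij|ij] := eqVneq i0 i.
        case: _ / ij in x xc x1 hx *; move: hx => /(@glue_inj _ _ c).
        by move=> <-.
      by move/eqP: hx; rewrite glue_neq // base1_neq_center.
  rewrite (prod_block i0 (-2)) ?m6; [|exact: Wleaf|by rewrite -/h tpermR].
  rewrite (eq_bigr (fun i => ((m i)%:Z - 6) *+ 2 * (-2) ^+ (m i - 2))) => [|i ii0].
    by rewrite !mulrA -mulNr.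
  apply: prod_block; first exact: Wleaf.
  rewrite tpermD.
  - by rewrite /arrow_mx !coal_fun_glue ?base1_neq_center // !eqxx.
  - by rewrite eq_sym glue_eqNone base1_neq_center.
  - by rewrite /h glue_neq ?base1_neq_center // eq_sym.
have Wdiag w z : w != None -> z != None -> arrow_mx w z != 0 -> w = z.
  case: (coalP w) => [//|i x xc] _; case: (coalP z) => [//|j y yc] _.
  rewrite /arrow_mx !coal_fun_glue //; have [ij|//] := eqVneq i j.
  by case: _ / ij in y yc *; case: (nat_of_ord x =P y) => [/val_inj->|].
have Whh : arrow_mx h h = 0.
  by rewrite /arrow_mx /h !coal_fun_glue ?base1_neq_center //= !eqxx m6.
rewrite /r; case: tpermP => [vN|vh|vN vh].
- have [uN|uN] := eqVneq u None; first by rewrite uN vN eqxx in uv.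
  by move=> W0; have uh := Wdiag _ _ uN _ W0; rewrite uh ?Whh ?eqxx // eq_sym in W0.
- by move=> _; rewrite vh in uv *; rewrite eqxx (negPf uv) [h == None]eq_sym (negPf hN); case: ifP.
- move=> W0; have [uN|uN] := eqVneq u None.
    by move/eqP/negPf: vN => ->; case: eqP.
  by move/eqP: vN => /(Wdiag _ _ uN)/(_ W0) /eqP; rewrite (negPf uv).
Qed.

(** For one block of order 6 among blocks of arbitrary orders; each other block
contributes the sum [(-1)^m 2^(m-3) (m-6)] of the cofactors of the distance
matrix of [T_m]. *)
Lemma det_T_dist i0 : m i0 = 6%N ->
  \det (fmx D) =
    - 16 * \prod_(i | i != i0) ((-1) ^+ m i * 2 ^+ (m i - 3) * ((m i)%:Z - 6)).
Proof.
move=> m6.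
have -> : \det (fmx D) = \det (fmx star_mx).
  rewrite -[LHS]mul1r -(expr1n _ 2) -det_tree_mx -(det_congruence D tree_mxE).
  by congr (\det _); apply/matrixP=> i j; rewrite !mxE tree_diff_dist.
have : \det (fmx arrow_mx) = (2 ^+ #|I|) ^+ 2 * \det (fmx star_mx).
  rewrite -det_star_diff_mx -(det_congruence _ star_diff_mxE).
  congr (\det _); apply/matrixP=> i j; rewrite !mxE -star_diff_rows.
  by apply: eq_star_diff => u; rewrite -star_diff_cols.
have -> : (2 ^+ #|I|) ^+ 2 = 4 * \prod_(i | i != i0) 4 :> int.
  by rewrite -exprM mulnC exprM -prodr_const (bigD1 i0).
have -> : \det (fmx arrow_mx) = - 64 * (\prod_(i | i != i0) 4 *
    \prod_(i | i != i0) ((-1) ^+ m i * 2 ^+ (m i - 3) * ((m i)%:Z - 6))).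
  rewrite (det_arrow_mx m6) -big_split /=; congr (_ * _); apply: eq_bigr => i _.
  have [k ->] : exists k, m i = (k + 3)%N.
    by exists (m i - 3)%N; have := order_gt2 i; lia.
  have -> : (k + 3 - 2 = k.+1)%N by lia.
  by rewrite addnK [(- 2) ^+ _]exprNn !(exprS _ k) exprD; ring.
set P := \prod_(i | _) 4; set Q := \prod_(i | _) _ => E.
(* Each block accounts for a factor 4, the square of its factor 2 in the
   determinant of [star_diff_mx]. *)
have P0 : 4 * P != 0 by rewrite /P prodr_const -exprS expf_neq0.
by apply: (mulfI P0); rewrite -E; ring.
Qed.

End TCoalescence.

Theorem theorem5p1 (b n : nat) (hb : (1 <= b)%N) (hn : (3 <= n)%N) (hn6 : n <> 6%N)
    (c : forall i : option 'I_b, 'I_(block_order n i))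
    (hc : forall i : option 'I_b, ~~ T_base (c i)) :
  \det (dist_mx (T6_coal_adj c)) =
    (-1) ^+ (n * b + 1) * 2 ^+ ((n - 3) * b + 4) * (n%:Z - 6) ^+ b.
Proof.
have T_distP (i : option (ordinal b)) : is_dist (@T_adj (block_order n i)) (@T_dist (block_order n i)).
  exact: T_is_dist (order_gt2 hc i).
have -> : dist_mx (T6_coal_adj c) =
    fmx (fun u v => Posz (coal_dist (fun i => @T_dist (block_order n i)) u v)).
  by apply/matrixP=> i j; rewrite !mxE (graph_distE (coalescence_is_dist c T_distP)).
rewrite (det_T_dist hc (i0 := None)) //.
rewrite (eq_bigr (fun=> (-1) ^+ n * 2 ^+ (n - 3) * (n%:Z - 6))) => [|[] //].
rewrite prodr_const cardC1 card_option card_ord /=.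
by rewrite !exprMn -!exprM !exprD; ring.
Qed.
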